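(* Let $G$ be a connected $\{K_{1,3},Z_{2}\}$-free graph. Then $G$ is not $B_{1,1}$-free (i.e., $G$ contains $B_{1,1}$ as an induced subgraph) if and only if $G$ is isomorphic to a member of $\bigcup_{0\leq i\leq 8}\mathcal{H}_{i}$.
   Context: All graphs are finite and simple. For a family $\mathcal{F}$ of graphs, a graph $G$ is $\mathcal{F}$-free if $G$ contains no member of $\mathcal{F}$ as an induced subgraph; $F$-free means $\{F\}$-free. $K_{1,3}$ is the star with three leaves. $Z_{2}$ is the graph obtained from a triangle $abc$ by adding a path $a d e$ with new vertices $d,e$ (so edges $ab,bc,ca,ad,de$). $B_{1,1}$ is the graph obtained from a triangle $abc$ by adding two new vertices $p,q$ with $p$ adjacent only to $a$ and $q$ adjacent only to $b$. Generalized comb: let $m\geq 3$; let $L_{1},\dots,L_{m}$ and $C$ be pairwise vertex-disjoint nonempty cliques with $|C|\geq m$, and let $R_{1},\dots,R_{m}$ be pairwise disjoint nonempty subsets of $C$. The generalized comb is the graph on $L_{1}\cup\dots\cup L_{m}\cup C$ in which each $L_i$ and $C$ are cliques, every vertex of $L_i$ is adjacent to every vertex of $R_i$, and there are no other edges. It is pointed if $|L_i|=1$ for all $i$. $\mathcal{H}_{0}$ is the family of pointed generalized combs. Expansion: given a graph $H$, a set $U\subseteq V(H)$ of expandable vertices, and a family $\mathcal{C}=\{C_a\mid a\in U\}$ of pairwise disjoint nonempty cliques (disjoint from $V(H)\setminus U$), $H(\mathcal{C})$ is the graph obtained by replacing each $a\in U$ by the clique $C_a$: its vertex set is $(V(H)\setminus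 U)\cup\bigcup_{a\in U}C_a$; edges among $V(H)\setminus U$ are as in $H$; each $C_a$ is a clique; a vertex of $C_a$ is adjacent to $u\in V(H)\setminus U$ iff $au\in E(H)$; for distinct $a,b\in U$, all vertices of $C_a$ are adjacent to all vertices of $C_b$ if $ab\in E(H)$ and none otherwise. The graphs $H_1,\dots,H_8$: $H_1$: vertices $s_1,\dots,s_5$, edges $s_3s_4,s_4s_5,s_5s_3,s_1s_3,s_2s_4$; expandable set $U_1=\{s_3,s_4,s_5\}$ ($H_1\cong B_{1,1}$). $H_2$: vertices $t_1,\dots,t_6$, edges $t_1t_2,t_2t_3,t_2t_4,t_3t_4,t_3t_5,t_4t_6,t_5t_6$; $U_2=\{t_3,t_4\}$. $H_3$: vertices $u_1,\dots,u_6$, edges $u_1u_2,u_1u_3,u_2u_4,u_3u_5,u_6u_2,u_6u_3,u_6u_4,u_6u_5$; $U_3=\{u_6\}$. $H_4$: vertices $v_1,\dots,v_6$, edges $v_4v_5,v_5v_6,v_6v_4,v_1v_4,v_1v_6,v_2v_4,v_2v_5,v_3v_5,v_3v_6$; $U_4=\{v_4,v_5,v_6\}$. $H_5$: vertices $w_1,\dots,w_7$, edges $w_1w_3,w_1w_5,w_3w_4,w_5w_6,w_2w_4,w_2w_6,w_7w_3,w_7w_4,w_7w_5,w_7w_6$; $U_5=\{w_7\}$. $H_6$: vertices $x_1,\dots,x_7$, edges $x_1x_2,x_1x_3,x_1x_5,x_3x_5,x_3x_4,x_2x_4,x_2x_6,x_4x_6,x_5x_6,x_5x_7,x_6x_7$.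 $H_7$: vertices $y_1,\dots,y_8$, edges $y_1y_2,y_1y_3,y_1y_5,y_2y_4,y_2y_6,y_3y_4,y_3y_5,y_3y_7,y_4y_6,y_4y_7,y_5y_6,y_5y_8,y_6y_8,y_7y_8$. $H_8$: obtained from $H_7$ (with vertices renamed $z_1,\dots,z_8$ in place of $y_1,\dots,y_8$) by adding a vertex $z_9$ adjacent exactly to $z_1,z_2,z_7,z_8$. For $1\leq i\leq 5$, $\mathcal{H}_i=\{H_i(\mathcal{C})\mid \mathcal{C}=\{C_a\mid a\in U_i\}$ a family of pairwise disjoint nonempty cliques$\}$; for $6\leq j\leq 8$, $\mathcal{H}_j=\{H_j\}$. *)

(* Defs.v *)
From HB Require Import structures.
From mathcomp Require Import all_boot.

Set Implicit Arguments.
Unset Strict Implicit.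
Unset Printing Implicit Defensive.

Record sgraph := SGraph {
  vertex :> finType;
  adj : rel vertex;
  adj_sym : symmetric adj;
  adj_irrefl : irreflexive adj }.

Definition isomorphic (G H : sgraph) : Prop :=
  exists f : G -> H, bijective f /\ forall x y, adj (f x) (f y) = adj x y.

Section Induced.
Variables (G : sgraph) (S : {set G}).

Definition induced_adj : rel {x : G | x \in S} :=
  fun x y => adj (val x) (val y).

Lemma induced_sym : symmetric induced_adj.
Proof. by move=> x y; apply: adj_sym. Qed.

Lemma induced_irrefl : irreflexive induced_adj.
Proof. by move=> x; apply: adj_irrefl. Qed.

Definition induced : sgraph := SGraph induced_sym induced_irrefl.

End Induced.

Definition has_induced (G H : sgraph) : Prop :=
  exists S : {set G}, isomorphic (induced S) H.

Definition family := sgraph -> Prop.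

Definition free (F : family) (G : sgraph) : Prop :=
  forall H, F H -> ~ has_induced G H.

Definition single (H : sgraph) : family := fun K => K = H.
Definition pair_family (H1 H2 : sgraph) : family := fun K => K = H1 \/ K = H2.

Definition connected (G : sgraph) : Prop :=
  forall x y : G, connect (@adj G) x y.

(* The graph with vertices 1, ..., n and edge list E. The vertex named k is the
   ordinal of value k - 1. *)
Section EdgeList.
Variables (n : nat) (E : seq (nat * nat)).

Definition edge_list_adj : rel 'I_n := fun x y =>
  (x != y) && (((x.+1, y.+1) \in E) || ((y.+1, x.+1) \in E)).

Lemma edge_list_sym : symmetric edge_list_adj.
Proof. by move=> x y; rewrite /edge_list_adj eq_sym orbC. Qed.

Lemma edge_list_irrefl : irreflexive edge_list_adj.
Proof. by move=> x; rewrite /edge_list_adj eqxx. Qed.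

Definition edge_list_graph : sgraph := SGraph edge_list_sym edge_list_irrefl.

Definition named (s : seq nat) : {set 'I_n} := [set x : 'I_n | x.+1 \in s].

End EdgeList.

Definition K13 := edge_list_graph 4 [:: (1, 2); (1, 3); (1, 4)].

(* a, b, c, d, e are 1, 2, 3, 4, 5. *)
Definition Z2 :=
  edge_list_graph 5 [:: (1, 2); (2, 3); (3, 1); (1, 4); (4, 5)].

(* a, b, c, p, q are 1, 2, 3, 4, 5. *)
Definition B11 :=
  edge_list_graph 5 [:: (1, 2); (2, 3); (3, 1); (1, 4); (2, 5)].

(* The cliques L_i and C are given by their vertex types; their pairwise
   disjointness comes from the disjoint sum. *)
Section GeneralizedComb.
Variables (m : nat) (L : 'I_m -> finType) (C : finType) (R : 'I_m -> {set C}).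

Definition gcomb_vertex : finType := ({i : 'I_m & L i} + C)%type.

Definition gcomb_adj : rel gcomb_vertex := fun u v =>
  match u, v with
  | inl p, inl q => (p != q) && (tag p == tag q)
  | inl p, inr c => c \in R (tag p)
  | inr c, inl p => c \in R (tag p)
  | inr c, inr d => c != d
  end.

Lemma gcomb_sym : symmetric gcomb_adj.
Proof. by move=> [p|c] [q|d] //=; rewrite eq_sym // [tag p == _]eq_sym. Qed.

Lemma gcomb_irrefl : irreflexive gcomb_adj.
Proof. by move=> [p|c] /=; rewrite eqxx. Qed.

Definition gcomb : sgraph := SGraph gcomb_sym gcomb_irrefl.

Definition gcomb_axiom : Prop :=
  [/\ 3 <= m,
      forall i, 0 < #|L i|,
      m <= #|C|,
      forall i, R i != set0
    & forall i j, i != j -> [disjoint R i & R j]].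

Definition pointed : Prop := forall i, #|L i| = 1.

End GeneralizedComb.

Definition pointed_gcombs : family := fun K =>
  exists (m : nat) (L : 'I_m -> finType) (C : finType) (R : 'I_m -> {set C}),
    [/\ gcomb_axiom L R, pointed L & K = gcomb L R].

(* H(C): the vertices outside U, together with, for each a in U, a copy of C a;
   the disjointness of the cliques comes from the disjoint sum. *)
Section Expansion.
Variables (H : sgraph) (U : {set H}) (C : {a : H | a \in U} -> finType).

Definition expansion_vertex : finType :=
  ({x : H | x \notin U} + {a : {a : H | a \in U} & C a})%type.

Definition expansion_adj : rel expansion_vertex := fun u v =>
  match u, v with
  | inl x, inl y => adj (val x) (val y)
  | inl x, inr p => adj (val x) (val (tag p))
  | inr p, inl x => adj (val (tag p)) (val x)
  | inr p, inr q => if tag p == tag q then p != q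
                    else adj (val (tag p)) (val (tag q))
  end.

Lemma expansion_sym : symmetric expansion_adj.
Proof.
move=> [x|p] [y|q] //=; try exact: adj_sym.
by rewrite [tag p == _]eq_sym [p == q]eq_sym adj_sym.
Qed.

Lemma expansion_irrefl : irreflexive expansion_adj.
Proof. by move=> [x|p] /=; rewrite ?adj_irrefl ?eqxx. Qed.

Definition expansion : sgraph := SGraph expansion_sym expansion_irrefl.

End Expansion.

Definition expansions (H : sgraph) (U : {set H}) : family := fun K =>
  exists C : {a : H | a \in U} -> finType,
    (forall a, 0 < #|C a|) /\ K = expansion C.

Definition H1 :=
  edge_list_graph 5 [:: (3, 4); (4, 5); (5, 3); (1, 3); (2, 4)].
Definition U1 : {set H1} := named 5 [:: 3; 4; 5].

Definition H2 :=
  edge_list_graph 6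
    [:: (1, 2); (2, 3); (2, 4); (3, 4); (3, 5); (4, 6); (5, 6)].
Definition U2 : {set H2} := named 6 [:: 3; 4].

Definition H3 :=
  edge_list_graph 6
    [:: (1, 2); (1, 3); (2, 4); (3, 5); (6, 2); (6, 3); (6, 4); (6, 5)].
Definition U3 : {set H3} := named 6 [:: 6].

Definition H4 :=
  edge_list_graph 6
    [:: (4, 5); (5, 6); (6, 4); (1, 4); (1, 6); (2, 4); (2, 5); (3, 5); (3, 6)].
Definition U4 : {set H4} := named 6 [:: 4; 5; 6].

Definition H5 :=
  edge_list_graph 7
    [:: (1, 3); (1, 5); (3, 4); (5, 6); (2, 4); (2, 6); (7, 3); (7, 4); (7, 5);
        (7, 6)].
Definition U5 : {set H5} := named 7 [:: 7].

Definition H6 :=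
  edge_list_graph 7
    [:: (1, 2); (1, 3); (1, 5); (3, 5); (3, 4); (2, 4); (2, 6); (4, 6); (5, 6);
        (5, 7); (6, 7)].

Definition H7_edges : seq (nat * nat) :=
  [:: (1, 2); (1, 3); (1, 5); (2, 4); (2, 6); (3, 4); (3, 5); (3, 7); (4, 6);
      (4, 7); (5, 6); (5, 8); (6, 8); (7, 8)].
Definition H7 := edge_list_graph 8 H7_edges.

Definition H8 :=
  edge_list_graph 9 (H7_edges ++ [:: (9, 1); (9, 2); (9, 7); (9, 8)]).

Definition calH (i : nat) : family :=
  match i with
  | 0 => pointed_gcombs
  | 1 => expansions U1
  | 2 => expansions U2
  | 3 => expansions U3
  | 4 => expansions U4
  | 5 => expansions U5
  | 6 => single H6
  | 7 => single H7
  | 8 => single H8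
  | _ => fun _ => False
  end.

Definition calH_union : family := fun K => exists i, i <= 8 /\ calH i K.

(* Main.v *)
(** Call the set of neighbours of a vertex x in an induced copy of a small graph
H the trace of x.  In a graph avoiding K_{1,3}, Z_2 and suitable members of the
list H_1, ..., H_8, the only traces on a copy of H_i are the empty one and the
closed neighbourhoods of expandable vertices; this is a finite check.  It forces
the whole graph to be an expansion of H_i: replacing a by a twin of a gives
another copy of H_i, so applying the check to this copy determines the adjacency
between two twins, and shows that no vertex is adjacent to a twin but has empty
trace.  Treating H_8, H_7, ..., H_2 in this order, a graph containing none of
these either contains the net, where one more trace occurs and the vertices with
non-empty trace form the clique of a comb, or is an expansion of H_1. *)

Require Import Defs.
From HB Require Import structures.
From mathcomp Require Import all_boot.

Set Implicit Arguments.
Unset Strict Implicit.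
Unset Printing Implicit Defensive.

(** * Isomorphisms and induced embeddings *)

Lemma inj_surj_bij (T T' : finType) (f : T -> T') :
  injective f -> (forall y, exists x, f x = y) -> bijective f.
Proof.
move=> f_inj f_surj; apply: inj_card_bij => //.
rewrite -(card_codom f_inj) subset_leq_card //; apply/subsetP=> y _.
by have [x <-] := f_surj y; apply: codom_f.
Qed.

Lemma isomorphic_sym G H : isomorphic G H -> isomorphic H G.
Proof.
case=> f [[g fK gK] f_adj]; exists g; split; first by exists f.
by move=> x y; rewrite -f_adj !gK.
Qed.

Definition embeds (H G : sgraph) : Prop :=
  exists f : H -> G, injective f /\ forall x y, adj (f x) (f y) = adj x y.

Lemma embeds_trans H K G : embeds H K -> embeds K G -> embeds H G.
Proof.
case=> f [f_inj f_adj] [g [g_inj g_adj]]; exists (g \o f).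
by split=> [|x y /=]; [apply: inj_comp | rewrite g_adj].
Qed.

Lemma isomorphic_embeds G H : isomorphic G H -> embeds G H.
Proof. by case=> f [/bij_inj f_inj f_adj]; exists f. Qed.

Lemma has_inducedE G H : has_induced G H <-> embeds H G.
Proof.
split=> [[S iso_SH] | [f [f_inj f_adj]]].
  have [f [f_inj f_adj]] := isomorphic_embeds (isomorphic_sym iso_SH).
  by exists (fun x => val (f x)); split=> // x y /val_inj/f_inj.
exists (f @: [set: H]); apply: isomorphic_sym.
have fS x : f x \in f @: [set: H] by apply: imset_f.
exists (fun x => Sub (f x) (fS x) : induced _); split=> //.
apply: inj_surj_bij => [x y [] /f_inj // | [y yS]].
by have /imsetP[x _ def_y] := yS; exists x; apply: val_inj.
Qed.

(** Only finitely many maps need testing, so embedding is decidable and the main proof can branch on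
    it constructively. *)
Definition embedsb (H G : sgraph) : bool :=
  [exists f : {ffun H -> G},
     injectiveb f && [forall x, forall y, adj (f x) (f y) == adj x y]].

Lemma embedsP H G : reflect (embeds H G) (embedsb H G).
Proof.
apply: (iffP existsP) => [[f /andP[/injectiveP f_inj /forallP f_adj]] |].
  by exists f; split=> // x y; apply/eqP; move/forallP: (f_adj x).
case=> f [f_inj f_adj]; exists [ffun x => f x]; apply/andP; split.
  by apply/injectiveP=> x y; rewrite !ffunE => /f_inj.
by apply/forallP=> x; apply/forallP=> y; rewrite !ffunE f_adj.
Qed.

(** * Edge-list graphs on natural-number indices *)

Definition erel (E : seq (nat * nat)) : rel nat := fun i j =>
  (i != j) && (((i.+1, j.+1) \in E) || ((j.+1, i.+1) \in E)).

Lemma erel_sym E : symmetric (erel E).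
Proof. by move=> i j; rewrite /erel eq_sym orbC. Qed.

Lemma erel_irrefl E : irreflexive (erel E).
Proof. by move=> i; rewrite /erel eqxx. Qed.

(** Total functions on [nat] avoid ordinals in computations; only the values below [n] matter. The
    two equations are paired so that both serve for rewriting. *)
Definition copy (G : sgraph) (n : nat) (e : rel nat) (g : nat -> G) : Prop :=
  forall i j, i < n -> j < n ->
    ((g i == g j) = (i == j)) * (adj (g i) (g j) = e i j).

Lemma embeds_copy (G : sgraph) n E :
  embeds (edge_list_graph n.+1 E) G <-> exists g : nat -> G, copy n.+1 (erel E) g.
Proof.
split=> [[f [f_inj f_adj]] | [g g_copy]].
  exists (fun i => f (inord i)) => i j lt_in lt_jn.
  rewrite f_adj (inj_eq f_inj) /= /edge_list_adj -!val_eqE /= !inordK //.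
exists (fun i : 'I_n.+1 => g i); split=> i j => [/eqP|].
  by rewrite (g_copy i j _ _).1 // => /eqP/val_inj.
by rewrite (g_copy i j _ _).2 //= /edge_list_adj -val_eqE.
Qed.

(** * Searching for induced copies *)

(* Branching uses [if] rather than [||] and [&&]: the latter evaluate both
   arguments under call by value, which would defeat the pruning. *)
Fixpoint lazy_has (T : Type) (p : T -> bool) (s : seq T) : bool :=
  if s is x :: s' then (if p x then true else lazy_has p s') else false.

Lemma lazy_hasE (T : Type) (p : T -> bool) s : lazy_has p s = has p s.
Proof. by elim: s => //= x s ->; case: (p x). Qed.

Section Search.
Variables (A : rel nat) (N : nat).

Fixpoint fits (r : bitseq) (s : seq nat) (v : nat) : bool :=
  match r, s with
  | b :: r', u :: s' =>
    if eqn u v then false else if eqb (A u v) b then fits r' s' v else false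
  | _, _ => true
  end.

(* The images found so far are listed with the most recent one first. *)
Fixpoint search (rows : seq bitseq) (s : seq nat) : bool :=
  if rows is r :: rows' then
    lazy_has (fun v => if fits r s v then search rows' (v :: s) else false)
             (iota 0 N)
  else true.

Variable e : rel nat.

(** The descending order matches the images, which are stored with the most recent one first. *)
Fixpoint adj_row (j i : nat) : bitseq :=
  if i is i'.+1 then e j i' :: adj_row j i' else [::].

Definition adj_rows (j k : nat) : seq bitseq := [seq adj_row i i | i <- iota j k].

Fixpoint partial_copy (s : seq nat) : bool :=
  if s is v :: s' then fits (adj_row (size s') (size s')) s' v && partial_copy s'
  else true.

Lemma search_sound k s :
    partial_copy s -> all (gtn N) s -> search (adj_rows (size s) k) s ->
  exists t, [/\ size t = size s + k, partial_copy t & all (gtn N) t].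
Proof.
elim: k s => [|k IHk] s s_part s_lt /=.
  by exists s; rewrite addn0.
rewrite lazy_hasE => /hasP[v]; rewrite mem_iota add0n /= => lt_vN.
case: ifP => // fit_v found; rewrite addnS -addSn.
by apply: (IHk (v :: s)); rewrite //= ?fit_v ?lt_vN.
Qed.

Lemma fitsP j s v : fits (adj_row j (size s)) s v ->
  forall i, i < size s ->
    (nth 0 (rev s) i != v) /\ A (nth 0 (rev s) i) v = e j i.
Proof.
elim: s => //= u s IHs; rewrite eqnE; case: eqP => // /eqP neq_uv.
case: ifP => // /eqP Auv /IHs{}IHs i.
rewrite rev_cons nth_rcons size_rev ltnS leq_eqVlt => /predU1P[->|lt_is].
  by rewrite ltnn eqxx.
by rewrite lt_is; apply: IHs.
Qed.

Lemma partial_copyP s : partial_copy s ->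
  forall i j, i < j < size s ->
    (nth 0 (rev s) i != nth 0 (rev s) j) /\
    A (nth 0 (rev s) i) (nth 0 (rev s) j) = e j i.
Proof.
elim: s => [|v s IHs] /=; first by move=> _ i j; rewrite ltn0 andbF.
case/andP=> /fitsP fit_v /IHs{}IHs i j /andP[lt_ij].
rewrite rev_cons !nth_rcons size_rev ltnS leq_eqVlt => /predU1P[eq_j|lt_js].
  by rewrite -eq_j lt_ij ltnn eqxx eq_j; apply: fit_v; rewrite -eq_j.
by rewrite (ltn_trans lt_ij) // lt_js; apply: IHs; rewrite lt_ij.
Qed.

End Search.

Lemma search_copy (G : sgraph) (A : rel nat) N (h : nat -> G) k E :
    copy N A h -> search A N (adj_rows (erel E) 0 k.+1) [::] ->
  embeds (edge_list_graph k.+1 E) G.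
Proof.
move=> h_copy /(search_sound (s := [::]) isT isT)[t [sz_t t_part /allP t_lt]].
have{} t_lt i : i < k.+1 -> nth 0 (rev t) i < N.
  by move=> lt_ik; apply: t_lt; rewrite -mem_rev mem_nth // size_rev sz_t.
apply/embeds_copy; exists (fun i => h (nth 0 (rev t) i)).
have main i j : i < j < k.+1 ->
    ((h (nth 0 (rev t) i) == h (nth 0 (rev t) j)) = false) *
    (adj (h (nth 0 (rev t) i)) (h (nth 0 (rev t) j)) = erel E i j).
  move=> /andP[lt_ij lt_jk]; have lt_ik := ltn_trans lt_ij lt_jk.
  have [] := partial_copyP t_part (i := i) (j := j); first by rewrite lt_ij sz_t.
  move=> neq_ij Aij; rewrite !(h_copy _ _ (t_lt _ lt_ik) (t_lt _ lt_jk)).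
  by rewrite Aij erel_sym (negPf neq_ij).
move=> i j lt_ik lt_jk; case: (ltngtP i j) => [lt_ij | lt_ji | ->].
- by rewrite !main ?lt_ij.
- by rewrite eq_sym adj_sym !main ?lt_ji // erel_sym.
- by rewrite eqxx adj_irrefl erel_irrefl.
Qed.

(** Adjacency is stored as a bit matrix, so that [vm_compute] reads a bit at each query instead of
    scanning the edge list again. *)
Definition tabulate (n : nat) (e : rel nat) : seq bitseq :=
  mkseq (fun i => mkseq (e i) n) n.

Definition lookup (M : seq bitseq) : rel nat := fun i j =>
  nth false (nth [::] M i) j.

Lemma lookupE n e i j : i < n -> j < n -> lookup (tabulate n e) i j = e i j.
Proof. by move=> lt_in lt_jn; rewrite /lookup !nth_mkseq. Qed.

Lemma copy_lookup (G : sgraph) n e (g : nat -> G) :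
  copy n e g -> copy n (lookup (tabulate n e)) g.
Proof. by move=> g_copy i j ltin ltjn; rewrite !(g_copy i j) ?lookupE. Qed.

Lemma search_embeds (G : sgraph) n E k E' :
    embeds (edge_list_graph n.+1 E) G ->
    search (lookup (tabulate n.+1 (erel E))) n.+1 (adj_rows (erel E') 0 k.+1) [::] ->
  embeds (edge_list_graph k.+1 E') G.
Proof.
by case/embeds_copy=> g /copy_lookup g_copy; apply: search_copy g_copy.
Qed.

(** * One-vertex extensions *)

(** [S] is the trace of the new vertex [n]. Its bit at position [n] answers the query for the pair
    (n, n), hence the [false] appended to traces below. *)
Definition extend (e : rel nat) (n : nat) (S : bitseq) : rel nat := fun i j =>
  if eqn i n then nth false S j else if eqn j n then nth false S i else e i j.

Fixpoint bitseqs (n : nat) : seq bitseq :=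
  if n is n'.+1 then map (cons true) (bitseqs n') ++ map (cons false) (bitseqs n')
  else [:: [::]].

Lemma mem_bitseqs (S : bitseq) : S \in bitseqs (size S).
Proof.
elim: S => //= b S IHS; rewrite mem_cat.
by case: b; rewrite (map_f (cons _)) ?orbT.
Qed.

Definition trace (G : sgraph) n (g : nat -> G) (x : G) : bitseq :=
  mkseq (fun i => adj (g i) x) n.

Lemma copy_extend (G : sgraph) n e e' (g : nat -> G) x :
    copy n e g -> (forall i j, i < n -> j < n -> e' i j = e i j) ->
    (forall i, i < n -> g i != x) ->
  copy n.+1 (extend e' n (rcons (trace n g x) false))
       (fun i => if i < n then g i else x).
Proof.
move=> g_copy e'E g_fresh i j; rewrite !ltnS /extend !eqnE.
rewrite [i <= n]leq_eqVlt [j <= n]leq_eqVlt => /predU1P[->|lt_in] /predU1P[->|lt_jn].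
- by rewrite ltnn !eqxx adj_irrefl nth_rcons size_mkseq ltnn eqxx.
- rewrite lt_jn ltnn eqxx nth_rcons size_mkseq lt_jn nth_mkseq // adj_sym.
  by rewrite eq_sym (negPf (g_fresh j _)) // gtn_eqF.
- rewrite lt_in ltnn eqxx (ltn_eqF lt_in) nth_rcons size_mkseq lt_in nth_mkseq //.
  by rewrite (negPf (g_fresh i _)).
- by rewrite lt_in lt_jn !(g_copy i j) // e'E // (ltn_eqF lt_in) (ltn_eqF lt_jn).
Qed.

(* A pattern [(k, E)] stands for the edge-list graph on [k.+1] vertices. *)
Definition extension_check (n : nat) (e : rel nat)
    (allowed : pred bitseq) (forbidden : seq (nat * seq (nat * nat))) : bool :=
  let M := tabulate n e in
  let patterns := [seq adj_rows (erel p.2) 0 p.1.+1 | p <- forbidden] in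
  all (fun S =>
         if allowed S then true else
         let M' := tabulate n.+1 (extend (lookup M) n (rcons S false)) in
         lazy_has (fun p => search (lookup M') n.+1 p [::]) patterns)
      (bitseqs n).

Definition avoids (G : sgraph) (F : seq (nat * seq (nat * nat))) : Prop :=
  forall p, p \in F -> ~ embeds (edge_list_graph p.1.+1 p.2) G.

(** The trace of [x] is among the enumerated bit sequences. Were it not allowed, the search would
    have found a forbidden pattern in the copy enlarged by [x]. *)
Lemma extension_checkP (G : sgraph) n e allowed F (g : nat -> G) x :
    extension_check n e allowed F -> avoids G F -> copy n e g ->
    (forall i, i < n -> g i != x) -> allowed (trace n g x).
Proof.
move=> /allP check G_F g_copy g_fresh.
have /check : trace n g x \in bitseqs n.
  by rewrite -[X in bitseqs X](size_mkseq (fun i => adj (g i) x) n) mem_bitseqs.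
cbv zeta; case: ifP => // _; rewrite lazy_hasE has_map => /hasP[p /G_F not_p found].
case: not_p; apply: search_copy (found : is_true (search _ _ _ _)).
apply: copy_lookup.
by apply: (copy_extend g_copy) => // i j; apply: lookupE.
Qed.

(** * Recognising expansions *)

(** The fibres of [p] over [U] serve as the cliques; the other fibres are single vertices. *)
Lemma isomorphic_expansion (G H : sgraph) (U : {set H}) (p : G -> H) :
    (forall a, exists x, p x = a) ->
    (forall x y, p x = p y -> p x \notin U -> x = y) ->
    (forall x y, adj x y = if p x == p y then x != y else adj (p x) (p y)) ->
  exists K, expansions U K /\ isomorphic G K.
Proof.
move=> p_surj p_inj p_adj.
pose C (a : {a : H | a \in U}) : finType := {x : G | p x == val a}.
exists (expansion C); split.
  exists C; split=> // a; have [x px] := p_surj (val a).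
  by apply/card_gt0P; exists (exist _ x (introT eqP px)).
have p_surjb a : exists x, p x == a by have [x <-] := p_surj a; exists x.
pose r a := xchoose (p_surjb a).
have rK a : p (r a) = a by apply/eqP/(xchooseP (p_surjb a)).
pose g (u : expansion C) : G :=
  match u with inl a => r (val a) | inr q => val (tagged q) end.
have pg u : p (g u) = match u with inl a => val a | inr q => val (tag q) end.
  by case: u => [a|[a [x px]]] /=; [apply: rK | apply/eqP].
have tagged_inj (q q' : {a & C a}) : val (tagged q) = val (tagged q') -> q = q'.
  case: q q' => [a x] [b y] /= eq_xy; have eq_ab : a = b.
    apply: val_inj; apply: etrans (eqP (valP y)).
    by rewrite -(congr1 p eq_xy); apply/esym/eqP/(valP x).
  by subst b; congr existT; apply: val_inj.
have tag_neq (a : {a : H | a \notin U}) (q : {a & C a}) : val a <> val (tag q).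
  by case: a (tag q) => [a aU] [b bU] /= eq_ab; rewrite eq_ab bU in aU.
apply: isomorphic_sym; exists g; split.
  apply: inj_surj_bij => [u v eq_g | x].
    have := congr1 p eq_g; rewrite !pg.
    case: u v eq_g => [a|q] [b|q'] /=.
    - by move=> _ eq_ab; congr inl; apply: val_inj.
    - by move=> _ /tag_neq.
    - by move=> _ /esym/tag_neq.
    - by move=> /tagged_inj->.
  have [pxU | pxU] := boolP (p x \in U).
    by exists (inr (existT C (exist _ (p x) pxU) (exist _ x (eqxx (p x))))).
  exists (inl (exist _ (p x) pxU)) => /=.
  by apply: p_inj; rewrite rK.
move=> u v; rewrite p_adj !pg.
case: u v => [a|q] [b|q'] /=.
- by case: eqP => // ->; rewrite adj_irrefl eqxx.
- by case: eqP => // /tag_neq.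
- by case: eqP => // /esym/tag_neq.
rewrite -[tag q == _]val_eqE /=; case: eqP => // _; congr negb.
by apply/eqP/eqP => [/tagged_inj | ->].
Qed.

(** Pick one vertex in each clique; the projection back to [H] is a left inverse of this choice. *)
Lemma embeds_expansion (H : sgraph) (U : {set H}) K :
  expansions U K -> embeds H K.
Proof.
case=> C [C_gt0 ->].
have c a : C a := xchoose (elimT card_gt0P (C_gt0 a)).
pose f (a : H) : expansion C :=
  match decP (@idP (a \in U)) with
  | left aU => inr (existT _ (exist _ a aU) (c _))
  | right aU => inl (exist _ a (introN idP aU))
  end.
pose p (u : expansion C) : H :=
  match u with inl a => val a | inr q => val (tag q) end.
have fK : cancel f p by move=> a; rewrite /f; case: decP.
exists f; split=> [|a b]; first exact: can_inj fK.
have [<-|neq_ab] := eqVneq a b; first by rewrite !adj_irrefl.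
rewrite -{2}(fK a) -{2}(fK b).
have : p (f a) != p (f b) by rewrite !fK.
case: (f a) (f b) => [u|u] [v|v] //=.
by rewrite -[tag u == _]val_eqE => /negPf->.
Qed.

(** The closed neighbourhood of [a], that is, the trace left by a twin of [a]. *)
Definition twin_trace (e : rel nat) (a i : nat) : bool := (i == a) || e a i.

(* After a twin x of [a] is substituted for [a] in a copy, a twin y of [b] has
   this trace exactly when the adjacency of x and y is the wrong one. *)
Definition twin_trace_flip (e : rel nat) (a b i : nat) : bool :=
  twin_trace e b i (+) (i == a).

Section Classify.
Variables (G : sgraph) (n : nat) (E : seq (nat * nat)) (names : seq nat).
Hypothesis Gconn : connected G.
Let e := erel E.
Let H := edge_list_graph n.+1 E.
Let expandable a := (a < n.+1) && (a.+1 \in names).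

Hypothesis G_traces : forall (g : nat -> G) x,
  copy n.+1 e g -> (forall i, i < n.+1 -> g i != x) ->
  (forall i, i < n.+1 -> adj (g i) x = false) \/
  exists2 a, expandable a & forall i, i < n.+1 -> adj (g i) x = twin_trace e a i.
(** With the next hypothesis, a flipped trace is neither empty nor the trace of a twin, so
    [G_traces] excludes it. *)
Hypothesis flip_nonempty : forall a b, expandable a -> expandable b ->
  exists2 i, i < n.+1 & twin_trace_flip e a b i.
Hypothesis flip_not_twin : forall a b c,
  expandable a -> expandable b -> expandable c ->
  exists2 i, i < n.+1 & twin_trace_flip e a b i != twin_trace e c i.
Hypothesis no_isolated : forall a, expandable a -> exists2 i, i < n.+1 & e a i.

Definition replace (g : nat -> G) a x i := if i == a then x else g i.

Lemma replace_copy g a x :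
    copy n.+1 e g -> (forall i, i < n.+1 -> g i != x) ->
    (forall i, i < n.+1 -> adj (g i) x = twin_trace e a i) ->
  copy n.+1 e (replace g a x).
Proof.
move=> g_copy g_fresh x_twin i j lt_in lt_jn; rewrite /replace.
case: (altP (i =P a)) => [->|neq_ia]; case: (altP (j =P a)) => [->|neq_ja].
- by rewrite !eqxx adj_irrefl /e erel_irrefl.
- rewrite eq_sym (negPf (g_fresh j _)) // adj_sym x_twin // /twin_trace.
  by rewrite [a == j]eq_sym (negPf neq_ja).
- rewrite (negPf (g_fresh i _)) // x_twin // /twin_trace.
  by rewrite (negPf neq_ia) /e erel_sym.
- exact: g_copy.
Qed.

Variable g : nat -> G.
Hypothesis g_copy : copy n.+1 e g.

Definition twin_of (x : G) (a : nat) : bool :=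
  [&& a.+1 \in names, [forall i : 'I_n.+1, g i != x] &
      [forall i : 'I_n.+1, adj (g i) x == twin_trace e a i]].

Lemma twin_ofP x (a : 'I_n.+1) : reflect
  [/\ expandable a, forall i, i < n.+1 -> g i != x &
      forall i, i < n.+1 -> adj (g i) x = twin_trace e a i] (twin_of x a).
Proof.
apply: (iffP and3P) => [[a_exp /forallP g_fresh /forallP x_twin] | ].
  split=> [|i lt_in|i lt_in]; first by rewrite /expandable ltn_ord.
    exact: g_fresh (Ordinal lt_in).
  exact/eqP/(x_twin (Ordinal lt_in)).
case=> /andP[_ a_exp] g_fresh x_twin; split=> //; apply/forallP=> i.
  exact: g_fresh.
by rewrite x_twin.
Qed.

(** With [x] substituted for [a], the trace of [y] is unchanged away from [a] and equals [adj x y]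
    at [a]. The wrong value there would yield the flipped trace, which no vertex has. *)
Lemma twin_adj x y (a b : 'I_n.+1) :
  twin_of x a -> twin_of y b -> x != y -> adj x y = twin_trace e b a.
Proof.
move=> /twin_ofP[a_exp g_x x_twin] /twin_ofP[b_exp g_y y_twin] neq_xy.
have y_fresh i : i < n.+1 -> replace g a x i != y.
  by move=> lt_in; rewrite /replace; case: ifP => // _; apply: g_y.
have [|] := G_traces (replace_copy g_copy g_x x_twin) y_fresh.
  move=> y0; apply/eqP/idPn => neq_adj.
  have [i lt_in] := flip_nonempty a_exp b_exp.
  have := y0 i lt_in; rewrite /replace /twin_trace_flip.
  case: eqP => [-> y_x | _]; last by rewrite y_twin // addbF => ->.
  by rewrite y_x /= in neq_adj *; case: twin_trace neq_adj.
case=> c c_exp y_c; apply/eqP/idPn => neq_adj.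
have [i lt_in] := flip_not_twin a_exp b_exp c_exp.
rewrite -y_c // /replace /twin_trace_flip.
case: (i =P a :> nat) => [-> | _]; last by rewrite y_twin // addbF eqxx.
by case: twin_trace neq_adj => /=; case: adj.
Qed.

Definition in_class (x : G) (a : 'I_n.+1) : bool := (x == g a) || twin_of x a.

(** By connectivity it suffices that the vertices having a class are closed under adjacency. *)
Lemma in_class_total x : exists a, in_class x a.
Proof.
apply/existsP; pose D := [pred x | [exists a, in_class x a]].
have D_closed : closed (@adj G) D.
  apply: intro_closed; first exact/sym_connect_sym/adj_sym.
  move=> y z adj_yz /existsP[a y_a]; rewrite inE; apply: contraT => z_out.
  have z_fresh i : i < n.+1 -> g i != z.
    move=> lt_in; apply: contra z_out => /eqP<-; apply/existsP.
    by exists (Ordinal lt_in); rewrite /in_class eqxx.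
  have z_not_twin a' : ~ (expandable a' /\
      forall i, i < n.+1 -> adj (g i) z = twin_trace e a' i).
    case=> a'_exp z_twin; case/negP: z_out; apply/existsP.
    have [lt_an _] := andP a'_exp.
    by exists (Ordinal lt_an); rewrite /in_class; apply/orP; right; apply/twin_ofP.
  have [z0|[a' a'_exp z_twin]] := G_traces g_copy z_fresh; last first.
    by case: (z_not_twin a').
  case/orP: y_a adj_yz => [/eqP-> | /twin_ofP[a_exp y_fresh y_twin]] adj_yz.
    by rewrite z0 in adj_yz.
  have z_fresh' i : i < n.+1 -> replace g a y i != z.
    move=> lt_in; rewrite /replace; case: ifP => _; last exact: z_fresh.
    by apply: contraTneq adj_yz => ->; rewrite adj_irrefl.
  (* An unclassified neighbour [z] of a twin [y] of [a] sees only [y] in the modified copy. The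
     closed neighbourhood of some [c] would then be [a] alone, which forces c = a, against [a]
     having a neighbour. *)
  have z_tr i : i < n.+1 -> adj (replace g a y i) z = (i == a :> nat).
    by move=> lt_in; rewrite /replace; case: ifP => // _; apply: z0.
  have [z1|[c c_exp z_c]] :=
      G_traces (replace_copy g_copy y_fresh y_twin) z_fresh'.
    by have := z1 a (ltn_ord a); rewrite z_tr // eqxx.
  have eq_ca : c = a.
    have [lt_cn _] := andP c_exp; have := z_c c lt_cn.
    by rewrite z_tr // /twin_trace eqxx => /eqP.
  have [i lt_in e_ai] := no_isolated a_exp.
  have := z_c i lt_in; rewrite z_tr // /twin_trace eq_ca e_ai orbT => /eqP eq_ia.
  by rewrite eq_ia /e erel_irrefl in e_ai.
have := closed_connect D_closed (Gconn (g 0) x); rewrite !inE => <-.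
by apply/existsP; exists ord0; rewrite /in_class eqxx.
Qed.

Lemma expansion_classes : exists p : G -> H,
  [/\ forall a, exists x, p x = a,
      forall x y, p x = p y -> (p x).+1 \notin names -> x = y &
      forall x y, adj x y = if p x == p y then x != y else adj (p x) (p y)].
Proof.
pose p x : 'I_n.+1 := xchoose (in_class_total x).
have pP x : in_class x (p x) := xchooseP (in_class_total x).
exists p; split=> [a | x y eq_pxy px_fix | x y].
(* [g a] is not fresh, so it can lie in no class but that of [a]. *)
- exists (g a); case/orP: (pP (g a)) => [/eqP/eqP | /twin_ofP[_ g_fresh _]].
    by rewrite (g_copy _ _).1 // => /eqP/val_inj.
  by have := g_fresh a (ltn_ord a); rewrite eqxx.
- have fixP z : (p z).+1 \notin names -> z = g (p z).
    move=> pz_fix; case/orP: (pP z) => [/eqP // | /and3P[]].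
    by rewrite (negPf pz_fix).
  by rewrite (fixP x) // (fixP y) -eq_pxy.
have adjE a b : adj (a : H) b = e a b by rewrite /= /edge_list_adj -val_eqE.
have [<-|neq_xy] := eqVneq x y; first by rewrite eqxx adj_irrefl.
rewrite adjE /=.
(* One vertex in the copy and one twin: the trace of the twin decides. *)
have mixed u v : u = g (p u) -> twin_of v (p v) ->
    adj u v = if p u == p v then true else e (p u) (p v).
  move=> def_u /twin_ofP[_ _ v_twin].
  rewrite {1}def_u v_twin // /twin_trace -val_eqE; case: eqP => //= _.
  exact: erel_sym.
case/orP: (pP x) (pP y) => [/eqP def_x | tw_x] /orP[/eqP def_y | tw_y].
- case: eqP => [eq_p | _]; first by case/eqP: neq_xy; rewrite def_x def_y eq_p.
  by rewrite {1}def_x {1}def_y (g_copy _ _).2.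
- exact: mixed.
- by rewrite adj_sym mixed // [p y == _]eq_sym /e erel_sym.
- rewrite (twin_adj tw_x tw_y neq_xy) /twin_trace -val_eqE; case: eqP => //= _.
  exact: erel_sym.
Qed.
End Classify.

(** The conjuncts decide the hypotheses of the classification: admissible traces, expandable
    vertices with a neighbour, and the two conditions on flipped traces. *)
Definition expansion_check (n : nat) (E : seq (nat * nat)) (names : seq nat)
    (F : seq (nat * seq (nat * nat))) : bool :=
  let e := erel E in
  let I := iota 0 n in
  let U := [seq a <- I | a.+1 \in names] in
  let twins := [seq mkseq (twin_trace e a) n | a <- U] in
  [&& extension_check n e (fun S => S \in nseq n false :: twins) F,
      all (fun a => has (e a) I) U,
      all (fun a => all (fun b => has (twin_trace_flip e a b) I) U) U &
      all (fun a => all (fun b => all (fun c =>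
        has (fun i => twin_trace_flip e a b i != twin_trace e c i) I) U) U) U].

Section ExpansionCheck.
Variables (G : sgraph) (n : nat) (E : seq (nat * nat)) (names : seq nat).
Variable F : seq (nat * seq (nat * nat)).
Hypotheses (Gconn : connected G) (G_F : avoids G F).
Hypothesis G_H : embeds (edge_list_graph n.+1 E) G.
Hypothesis check : expansion_check n.+1 E names F.

Lemma expansion_check_classes : exists p : G -> edge_list_graph n.+1 E,
  [/\ forall a, exists x, p x = a,
      forall x y, p x = p y -> (p x).+1 \notin names -> x = y &
      forall x y, adj x y = if p x == p y then x != y else adj (p x) (p y)].
Proof.
have [g g_copy] := (embeds_copy G n E).1 G_H.
case/and4P: check => ext_ok /allP nbr_ok /allP flip1_ok /allP flip2_ok.
have mem_U a : (a < n.+1) && (a.+1 \in names) ->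
    a \in [seq a <- iota 0 n.+1 | a.+1 \in names].
  by rewrite mem_filter mem_iota add0n andbC.
have hasI (q : pred nat) : has q (iota 0 n.+1) -> exists2 i, i < n.+1 & q i.
  by case/hasP=> i; rewrite mem_iota => lt_in qi; exists i.
apply: (expansion_classes (names := names) Gconn _ _ _ _ g_copy).
- move=> h x h_copy h_fresh.
  have := extension_checkP ext_ok G_F h_copy h_fresh.
  cbv beta; rewrite in_cons => /predU1P[tr0 | /mapP[a]].
    left=> i lt_in; have := congr1 (fun S => nth false S i) tr0.
    by rewrite /trace nth_mkseq // nth_nseq lt_in.
  rewrite mem_filter mem_iota add0n andbC => /andP[lt_an a_names] tr_a.
  right; exists a; first by rewrite a_names andbT.
  move=> i lt_in; have := congr1 (fun S => nth false S i) tr_a.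
  by rewrite /trace !nth_mkseq.
- by move=> a b /mem_U/flip1_ok/allP ok_a /mem_U/ok_a/hasI.
- move=> a b c /mem_U/flip2_ok/allP ok_a /mem_U/ok_a/allP ok_b /mem_U/ok_b.
  exact: hasI.
- by move=> a /mem_U/nbr_ok/hasI.
Qed.

Lemma expansion_checkP :
  exists K, expansions (named n.+1 names : {set edge_list_graph n.+1 E}) K
            /\ isomorphic G K.
Proof.
have [p [p_surj p_inj p_adj]] := expansion_check_classes.
apply: (isomorphic_expansion p_surj) p_adj => x y eq_p.
by rewrite inE; apply: p_inj.
Qed.

End ExpansionCheck.

(** With no expandable vertex every fibre is a single vertex, and the empty trace is the only one
    allowed. *)
Lemma rigid_checkP (G : sgraph) n E F :
    connected G -> avoids G F -> embeds (edge_list_graph n.+1 E) G ->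
  expansion_check n.+1 E [::] F -> isomorphic G (edge_list_graph n.+1 E).
Proof.
move=> Gconn G_F G_H check.
have [p [p_surj p_inj p_adj]] := expansion_check_classes Gconn G_F G_H check.
have{} p_inj : injective p by move=> x y eq_p; apply: p_inj eq_p _.
exists p; split; first exact: inj_surj_bij.
move=> x y; rewrite p_adj (inj_eq p_inj).
by case: eqP => // ->; rewrite adj_irrefl.
Qed.

(** * Generalized combs *)

(** Each vertex outside [C] becomes a leaf clique of size one, and its neighbourhood in [C] the
    matching set [R]; no two leaves share a neighbour in [C], so these sets are disjoint. *)
Lemma isomorphic_gcomb (G : sgraph) (C : {set G}) :
    {in C &, forall x y, x != y -> adj x y} ->
    {in ~: C &, forall x y, ~~ adj x y} ->
    (forall x, x \notin C -> exists2 c, c \in C & adj c x) ->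
    (forall c x y, c \in C -> x \notin C -> y \notin C ->
       adj c x -> adj c y -> x = y) ->
    2 < #|~: C| ->
  exists K, pointed_gcombs K /\ isomorphic G K.
Proof.
move=> C_clique L_stable L_attached C_private gt2.
pose m := #|~: C|; pose leaf (i : 'I_m) : G := enum_val i.
have leafP i : leaf i \notin C by have := enum_valP i; rewrite inE.
have leaf_inj : injective leaf by apply: enum_val_inj.
pose L (i : 'I_m) : finType := unit.
pose CT : finType := {x : G | x \in C}.
pose R (i : 'I_m) : {set CT} := [set c | adj (val c) (leaf i)].
have R_ex i : exists c, c \in R i.
  have [c cC adj_c] := L_attached _ (leafP i).
  by exists (exist _ c cC); rewrite inE.
have R_inj i j c : c \in R i -> c \in R j -> i = j.
  rewrite !inE => ci cj; apply: leaf_inj.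
  by apply: (C_private (val c)) => //; apply: valP.
exists (gcomb L R); split.
  exists m, L, CT, R; split=> //; last by move=> i; rewrite card_unit.
  split=> //.
  - by move=> i; rewrite card_unit.
  (* Disjoint nonempty sets have distinct representatives, whence m <= |C|. *)
  - pose f i := xchoose (R_ex i).
    have f_inj : injective f.
      move=> i j eq_f; apply: (R_inj i j (f i)); first exact: xchooseP.
      by rewrite eq_f; apply: xchooseP.
    by rewrite -[m]card_ord; apply: leq_card f_inj.
  - by move=> i; apply/set0Pn; apply: R_ex.
  - move=> i j neq_ij; apply/pred0P=> c /=; apply/negP=> /andP[ci cj].
    by case/eqP: neq_ij; apply: R_inj ci cj.
pose h (u : gcomb L R) : G :=
  match u with inl p => leaf (tag p) | inr c => val c end.
have tag_inj (p q : {i : 'I_m & L i}) : tag p = tag q -> p = q.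
  by case: p q => [i []] [j []] /= ->.
apply: isomorphic_sym; exists h; split.
  apply: inj_surj_bij => [[p|c] [q|d] /= | x].
  - by move/leaf_inj/tag_inj->.
  - by move=> eq_pd; have := leafP (tag p); rewrite eq_pd (valP d).
  - by move=> eq_cq; have := leafP (tag q); rewrite -eq_cq (valP c).
  - by move/val_inj->.
  have [xC | xC] := boolP (x \in C); first by exists (inr (exist _ x xC)).
  have xL : x \in ~: C by rewrite inE.
  exists (inl (existT _ (enum_rank_in xL x) tt)) => /=.
  exact: enum_rankK_in.
move=> [p|c] [q|d] /=.
- rewrite (negPf (L_stable _ _ _ _)) ?inE //.
  by apply/esym/negP=> /andP[/eqP neq_pq /eqP/tag_inj].
- by rewrite inE adj_sym.
- by rewrite inE.
- have [<-|neq_cd] := eqVneq c d; first by rewrite adj_irrefl.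
  by apply: C_clique; rewrite ?(valP c) ?(valP d).
Qed.

Lemma embeds_seq (G : sgraph) E (x : G) (s : seq G) :
    uniq (x :: s) ->
    (forall i j, i < j < (size s).+1 ->
       adj (nth x (x :: s) i) (nth x (x :: s) j) = erel E i j) ->
  embeds (edge_list_graph (size s).+1 E) G.
Proof.
move=> uniq_s s_adj; apply/embeds_copy; exists (nth x (x :: s)) => i j lt_i lt_j.
rewrite nth_uniq //; split=> //; case: (ltngtP i j) => [lt_ij | lt_ji | ->].
- by rewrite s_adj ?lt_ij.
- by rewrite adj_sym erel_sym s_adj ?lt_ji.
- by rewrite adj_irrefl erel_irrefl.
Qed.

Lemma adj_neq (G : sgraph) (x y : G) : adj x y -> x != y.
Proof. by apply: contraTneq => ->; rewrite adj_irrefl. Qed.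

Lemma adj_separates (G : sgraph) (x y z : G) : adj x z -> ~~ adj y z -> x != y.
Proof. by move=> xz; apply: contraNneq => <-. Qed.

Lemma claw_free (G : sgraph) (c u v w : G) :
    ~ embeds K13 G -> adj c u -> adj c v -> adj c w ->
  u != v -> u != w -> v != w -> [|| adj u v, adj u w | adj v w].
Proof.
move=> no_claw cu cv cw uv uw vw; apply/negPn/negP; rewrite !negb_or.
case/and3P=> /negPf nuv /negPf nuw /negPf nvw.
case: no_claw; apply: (embeds_seq (x := c) (s := [:: u; v; w])).
  by rewrite /= !inE !negb_or uv uw vw !adj_neq.
by move=> [|[|[|[|i]]]] [|[|[|[|j]]]] //=;
  rewrite ?andbF // => _; rewrite ?cu ?cv ?cw ?nuv ?nuw ?nvw.
Qed.

Lemma Z2_free (G : sgraph) (a b c d e : G) :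
    ~ embeds Z2 G -> adj a b -> adj b c -> adj a c -> adj a d -> adj d e ->
  ~~ adj b d -> ~~ adj c d -> ~~ adj b e -> ~~ adj c e -> adj a e.
Proof.
move=> no_Z2 ab bc ac ad de nbd ncd nbe nce; apply/negPn/negP=> nae.
case: no_Z2; apply: (embeds_seq (x := a) (s := [:: b; c; d; e])).
  have ed : adj e d by rewrite adj_sym.
  have neb : ~~ adj e b by rewrite adj_sym.
  (* Non-adjacent vertices are distinguished by a third vertex adjacent to exactly one of the
     two. *)
  have [ae bd] := (adj_separates ab neb, adj_separates de nbe).
  have [be cd] := (adj_separates ed nbd, adj_separates de nce).
  have ce := adj_separates ed ncd.
  rewrite /= !inE !negb_or ae (eq_sym b d) bd (eq_sym b e) be (eq_sym c d) cd.
  by rewrite (eq_sym c e) ce !adj_neq.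
move=> [|[|[|[|[|i]]]]] [|[|[|[|[|j]]]]] //=;
  rewrite ?andbF // => _;
  by rewrite ?(ab, bc, ac, ad, de)
    ?(negPf nae, negPf nbd, negPf ncd, negPf nbe, negPf nce).
Qed.

(** * Graphs containing the net: recognising a comb *)

Definition net_edges : seq (nat * nat) :=
  [:: (1, 2); (2, 3); (3, 1); (1, 4); (2, 5); (3, 6)].
Definition net := edge_list_graph 6 net_edges.

Definition K13_Z2 : seq (nat * seq (nat * nat)) :=
  [:: (3, [:: (1, 2); (1, 3); (1, 4)]);
      (4, [:: (1, 2); (2, 3); (3, 1); (1, 4); (4, 5)])].

(** Empty, the triangle, or the triangle and one pendant vertex: indices 0, 1, 2 form the triangle
    and index 3 + i is pendant at i. *)
Definition net_traces : seq bitseq :=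
  [:: nseq 6 false; nseq 3 true ++ [:: false; false; false];
      nseq 3 true ++ [:: true; false; false];
      nseq 3 true ++ [:: false; true; false];
      nseq 3 true ++ [:: false; false; true]].

Lemma net_extension_check :
  extension_check 6 (erel net_edges) (fun S => S \in net_traces) K13_Z2.
Proof. by vm_compute. Qed.

Section Net.
Variable G : sgraph.
Hypotheses (Gconn : connected G) (G_free : avoids G K13_Z2).
Variable g : nat -> G.
Hypothesis g_copy : copy 6 (erel net_edges) g.

Let no_claw : ~ embeds K13 G.
Proof. exact: (G_free (p := (3, _))). Qed.

Let no_Z2 : ~ embeds Z2 G.
Proof. by apply: (G_free (p := (4, _))); rewrite !inE eqxx orbT. Qed.

Let r i := g i.
Let l i := g (3 + i).
Let fresh x := [forall i : 'I_6, g i != x].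

(** [b] tells whether [x] sees the triangle, and [j] which pendant vertex it then sees; a [j]
    outside 0, 1, 2 means none. *)
Lemma net_trace x : fresh x -> exists b j,
  forall i, i < 3 -> adj (r i) x = b /\ adj (l i) x = b && (i == j).
Proof.
move=> /forallP x_fresh.
have /(extension_checkP net_extension_check G_free g_copy) :
  forall i, i < 6 -> g i != x by move=> i lt_i6; apply: x_fresh (Ordinal lt_i6).
cbv beta; rewrite /trace /mkseq /= !inE.
case/or4P=> [/eqP[e0 e1 e2 e3 e4 e5]|/eqP[e0 e1 e2 e3 e4 e5]|
             /eqP[e0 e1 e2 e3 e4 e5]|].
- by exists false, 3 => -[|[|[|i]]].
- by exists true, 3 => -[|[|[|i]]].
- by exists true, 0 => -[|[|[|i]]].
case/orP=> /eqP[e0 e1 e2 e3 e4 e5].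
- by exists true, 1 => -[|[|[|i]]].
- by exists true, 2 => -[|[|[|i]]].
Qed.

Lemma net_adj i j : i < 3 -> j < 3 ->
  [/\ adj (r i) (r j) = (i != j), adj (r i) (l j) = (i == j),
      adj (l i) (l j) = false & (l i == l j) = (i == j)].
Proof.
move=> lt_i3 lt_j3; rewrite /r /l !g_copy ?(leq_trans lt_i3) ?(leq_trans lt_j3) //.
by case: i j lt_i3 lt_j3 => [|[|[|i]]] [|[|[|j]]].
Qed.

(** The future clique of the comb. By [net_trace], a fresh vertex that sees [r 0] sees the whole
    triangle. *)
Definition core := [set x | [exists i : 'I_3, x == r i] || fresh x && adj (r 0) x].

Variant net_vertex x : Prop :=
  | NetCore i of i < 3 & x = r i
  | NetLeaf i of i < 3 & x = l i
  | NetTwin of fresh x & adj (r 0) x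
  | NetFar of fresh x & adj (r 0) x = false.

Lemma net_vertexP x : net_vertex x.
Proof.
have [x_fresh | /forallPn[i /negPn/eqP<-]] := boolP (fresh x).
  by case adj_x: (adj (r 0) x); [apply: NetTwin | apply: NetFar].
have [lt_i3 | ge_i3] := ltnP i 3; first exact: NetCore lt_i3 _.
apply: (@NetLeaf _ (i - 3)); first by rewrite ltn_subLR.
by rewrite /l subnKC.
Qed.

Lemma fresh_r i : i < 3 -> fresh (r i) = false.
Proof.
move=> lt_i3; apply/negbTE/forallPn.
by exists (widen_ord (isT : 3 <= 6) (Ordinal lt_i3)); rewrite negbK.
Qed.

Lemma fresh_l i : i < 3 -> fresh (l i) = false.
Proof.
move=> lt_i3; apply/negbTE/forallPn.
by exists (rshift 3 (Ordinal lt_i3)); rewrite negbK.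
Qed.

Lemma core_r i : i < 3 -> r i \in core.
Proof.
move=> lt_i3; rewrite inE; apply/orP; left; apply/existsP.
by exists (Ordinal lt_i3).
Qed.

Lemma leaf_l i : i < 3 -> l i \notin core.
Proof.
move=> lt_i3; rewrite inE negb_or fresh_l // andbT; apply/existsPn=> j.
rewrite /l /r (g_copy _ _).1 ?ltn_add2l ?(leq_trans (ltn_ord j)) //.
by rewrite gtn_eqF // (leq_trans (ltn_ord j)) // leq_addr.
Qed.

Lemma coreP x : x \in core ->
  (exists2 i, i < 3 & x = r i) \/ (fresh x /\ adj (r 0) x).
Proof.
rewrite inE => /orP[/existsP[i /eqP->] | /andP[]]; last by right.
by left; exists i.
Qed.

Lemma leafP x : x \notin core ->
  (exists2 i, i < 3 & x = l i) \/ (fresh x /\ adj (r 0) x = false).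
Proof.
case: (net_vertexP x) => [i lt_i3 -> | i lt_i3 -> | x_fresh x_r | x_fresh x_r].
- by rewrite core_r.
- by left; exists i.
- by rewrite inE x_fresh x_r orbT.
- by right.
Qed.

Lemma twin_r x i : fresh x -> adj (r 0) x -> i < 3 -> adj (r i) x.
Proof. by move=> /net_trace[b [j tr]] x_r /tr[->]; rewrite -(tr 0 isT).1. Qed.

Lemma far_net x i : fresh x -> adj (r 0) x = false -> i < 3 ->
  adj (r i) x = false /\ adj (l i) x = false.
Proof.
move=> /net_trace[b [j tr]] x_r /tr[-> ->].
by have [<- _] := tr 0 isT; rewrite x_r.
Qed.

Lemma twin_l x i j : fresh x -> i < 3 -> j < 3 -> i != j ->
  adj (l i) x -> ~~ adj (l j) x.
Proof.
move=> /net_trace[b [k tr]] lt_i3 lt_j3 neq_ij.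
rewrite (tr i lt_i3).2 (tr j lt_j3).2 => /andP[-> /eqP <-] /=.
by rewrite eq_sym.
Qed.

(** Each fresh vertex sees at most one of the three pendant vertices, so two fresh vertices miss a
    common one. *)
Lemma common_non_leaf x y : fresh x -> fresh y ->
  exists i, [/\ i < 3, ~~ adj (l i) x & ~~ adj (l i) y].
Proof.
move=> /net_trace[b [j tr_x]] /net_trace[b' [j' tr_y]].
have [i lt_i3 /andP[/negPf neq_j /negPf neq_j']] :
    exists2 i, i < 3 & (i != j) && (i != j').
  case: j j' {tr_x tr_y} => [|[|j]] [|[|j']];
    by do ?[by exists 0 | by exists 1 | by exists 2].
by exists i; rewrite (tr_x i lt_i3).2 (tr_y i lt_i3).2 neq_j neq_j' !andbF.
Qed.

(** For fresh [x] and [y], take a pendant [l i] missed by both: without the edge xy there is a claw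
    centred at [r i]. *)
Lemma core_clique : {in core &, forall x y, x != y -> adj x y}.
Proof.
move=> x y /coreP[[i lt_i3 ->]|[x_fresh x_r]] /coreP[[j lt_j3 ->]|[y_fresh y_r]] neq.
- by have [-> _ _ _] := net_adj lt_i3 lt_j3; apply: contraNneq neq => ->.
- exact: twin_r.
- by rewrite adj_sym; apply: twin_r.
have [i [lt_i3 nlx nly]] := common_non_leaf x_fresh y_fresh.
have [_ r_l _ _] := net_adj lt_i3 lt_i3; rewrite eqxx in r_l.
have l_neq z : fresh z -> l i != z.
  by move=> z_fresh; apply: contraTneq z_fresh => <-; rewrite fresh_l.
have := claw_free no_claw r_l (twin_r x_fresh x_r lt_i3) (twin_r y_fresh y_r lt_i3).
by rewrite (negPf nlx) (negPf nly); apply; rewrite ?l_neq.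
Qed.

Lemma far_core_nbr c x : c \in core -> fresh x -> adj (r 0) x = false ->
  adj c x -> fresh c /\ adj (r 0) c.
Proof.
move=> /coreP[[i lt_i3 ->] | //] x_fresh x_r.
by rewrite (far_net x_fresh x_r lt_i3).1.
Qed.

(** Otherwise the triangle [c], [r 0], [r 1] and the path [c], [x], [y] induce [Z2]. *)
Lemma far_far_core c x y : c \in core -> fresh x -> adj (r 0) x = false ->
  fresh y -> adj (r 0) y = false -> adj c x -> adj x y -> adj c y.
Proof.
move=> c_core x_fresh x_r y_fresh y_r cx xy.
have [c_fresh c_r] := far_core_nbr c_core x_fresh x_r cx.
have [rr _ _ _] := net_adj (isT : 0 < 3) (isT : 1 < 3).
apply: (Z2_free no_Z2 (b := r 0) (c := r 1) _ rr _ cx xy).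
- by rewrite adj_sym.
- by rewrite adj_sym twin_r.
- by rewrite x_r.
- by rewrite (far_net x_fresh x_r (isT : 1 < 3)).1.
- by rewrite y_r.
- by rewrite (far_net y_fresh y_r (isT : 1 < 3)).1.
Qed.

(** By connectivity it suffices that being in the core or having a neighbour there spreads along
    edges; between two far vertices, [far_far_core] passes on the same neighbour. *)
Lemma leaf_attached x : x \notin core -> exists2 c, c \in core & adj c x.
Proof.
pose D := [pred x | (x \in core) || [exists c in core, adj c x]].
have inD y : (y \in D) = (y \in core) || [exists c in core, adj c y] by [].
suff : x \in D.
  by rewrite inD => /orP[-> // | /exists_inP[c c_core cx] _]; exists c.
have D_closed : closed (@adj G) D.
  apply: intro_closed; first exact/sym_connect_sym/adj_sym.
  move=> y z yz; rewrite !inD.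
  have [y_core _ | /leafP y_leaf /= y_att] := boolP (y \in core).
    by apply/orP; right; apply/exists_inP; exists y.
  have [z_core | /leafP z_leaf /=] := boolP (z \in core); first by [].
  case: z_leaf yz => [[i lt_i3 ->] _ | [z_fresh z_r] yz].
    apply/exists_inP; exists (r i); first exact: core_r.
    by have [_ -> _ _] := net_adj lt_i3 lt_i3.
  case: y_leaf yz y_att => [[i lt_i3 ->] | [y_fresh y_r] yz].
    by rewrite (far_net z_fresh z_r lt_i3).2.
  case/exists_inP=> c c_core cy; apply/exists_inP; exists c => //.
  exact: far_far_core cy yz.
by rewrite -(closed_connect D_closed (Gconn (r 0) x)) inD core_r.
Qed.

(** Adjacent far vertices would share a core neighbour [c]. For a pendant [l i] missed by [c], the
    triangle [c], [x], [y] and the path [c], [r i], [l i] would induce [Z2]. *)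
Lemma far_stable x y : fresh x -> adj (r 0) x = false ->
  y \notin core -> ~~ adj x y.
Proof.
move=> x_fresh x_r /leafP[[i lt_i3 ->] | [y_fresh y_r]].
  by rewrite adj_sym (far_net x_fresh x_r lt_i3).2.
apply/negP=> xy; have [|c c_core cx] := leaf_attached (x := x).
  rewrite inE negb_or x_fresh x_r andbT; apply/existsPn=> i.
  by apply: contraTneq x_fresh => ->; rewrite fresh_r.
have cy := far_far_core c_core x_fresh x_r y_fresh y_r cx xy.
have [c_fresh c_r] := far_core_nbr c_core x_fresh x_r cx.
have [i [lt_i3 ncl _]] := common_non_leaf c_fresh c_fresh.
have [_ r_l _ _] := net_adj lt_i3 lt_i3; rewrite eqxx in r_l.
case/negP: (ncl); rewrite adj_sym.
apply: (Z2_free no_Z2 cx xy cy (d := r i)) => //.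
- by rewrite adj_sym twin_r.
- by rewrite adj_sym (far_net x_fresh x_r lt_i3).1.
- by rewrite adj_sym (far_net y_fresh y_r lt_i3).1.
- by rewrite adj_sym (far_net x_fresh x_r lt_i3).2.
- by rewrite adj_sym (far_net y_fresh y_r lt_i3).2.
Qed.

Lemma leaf_stable : {in ~: core &, forall x y, ~~ adj x y}.
Proof.
move=> x y; rewrite !in_setC.
move=> /leafP[[i lt_i3 ->] | [x_fresh x_r]]; last exact: far_stable.
case/leafP=> [[j lt_j3 ->] | [y_fresh y_r]].
  by have [_ _ -> _] := net_adj lt_i3 lt_j3.
by rewrite (far_net y_fresh y_r lt_i3).2.
Qed.

(** Otherwise [c] is the centre of a claw with leaves [x], [y] and a triangle vertex. *)
Lemma core_private_far c x y : c \in core -> fresh x -> adj (r 0) x = false ->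
  y \notin core -> adj c x -> adj c y -> x = y.
Proof.
move=> c_core x_fresh x_r y_leaf cx cy; apply/eqP/negPn/negP=> neq_xy.
have [c_fresh c_r] := far_core_nbr c_core x_fresh x_r cx.
(* [y] may be a pendant vertex [l j]; the triangle vertex is then taken with an index other than
   [j]. *)
have [i lt_i3 nry] : exists2 i, i < 3 & adj (r i) y = false.
  case/leafP: (y_leaf) => [[j lt_j3 ->] | [y_fresh y_r]]; last by exists 0.
  have [i lt_i3 neq_ij] : exists2 i, i < 3 & i != j.
    by case: j {lt_j3} => [|j]; [exists 1 | exists 0].
  by exists i => //; have [_ -> _ _] := net_adj lt_i3 lt_j3; apply/negbTE.
have cr : adj c (r i) by rewrite adj_sym twin_r.
have r_neq z : z \notin core -> r i != z.
  by apply: contraNneq => <-; apply: core_r.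
have x_leaf : x \notin core.
  rewrite inE negb_or x_fresh x_r andbT; apply/existsPn=> j.
  by apply: contraTneq x_fresh => ->; rewrite fresh_r.
have := claw_free no_claw cr cx cy (r_neq _ x_leaf) (r_neq _ y_leaf) neq_xy.
by rewrite nry (far_net x_fresh x_r lt_i3).1 (negPf (far_stable x_fresh x_r y_leaf)).
Qed.

Lemma core_private c x y : c \in core -> x \notin core -> y \notin core ->
  adj c x -> adj c y -> x = y.
Proof.
move=> c_core x_leaf y_leaf cx cy.
have [[i lt_i3 def_x] | [x_fresh x_r]] := leafP x_leaf; last first.
  exact: (core_private_far c_core).
have [[j lt_j3 def_y] | [y_fresh y_r]] := leafP y_leaf; last first.
  by apply/esym; apply: (core_private_far c_core).
rewrite {x x_leaf}def_x in cx *; rewrite {y y_leaf}def_y in cy *; congr l.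
(* Both are pendant vertices: a triangle vertex sees only its own, and a fresh one at most one. *)
have [[k lt_k3 def_c] | [c_fresh _]] := coreP c_core.
  move: cx cy; rewrite def_c.
  have [_ -> _ _] := net_adj lt_k3 lt_i3; have [_ -> _ _] := net_adj lt_k3 lt_j3.
  by move=> /eqP<- /eqP.
apply/eqP/negPn/negP=> neq_ij; rewrite adj_sym in cx; rewrite adj_sym in cy.
by have := twin_l c_fresh lt_i3 lt_j3 neq_ij cx; rewrite cy.
Qed.

Lemma net_comb : exists K, pointed_gcombs K /\ isomorphic G K.
Proof.
apply: (isomorphic_gcomb core_clique leaf_stable leaf_attached core_private).
pose f (i : 'I_3) := l i.
have f_inj : injective f.
  move=> i j /eqP; have [_ _ _ ->] := net_adj (ltn_ord i) (ltn_ord j).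
  by move/eqP/val_inj.
rewrite -[3]card_ord -(card_imset _ f_inj) subset_leq_card //.
by apply/subsetP=> _ /imsetP[i _ ->]; rewrite in_setC leaf_l.
Qed.

End Net.

(** * Copies of [B11] in the listed graphs *)

Lemma gcomb_B11 K : pointed_gcombs K -> embeds B11 K.
Proof.
case=> m [L [C [R [[m_ge3 L_gt0 _ R_n0 R_disj] _ ->]]]].
pose i k (lt_k3 : k < 3) : 'I_m := Ordinal (leq_trans lt_k3 m_ge3).
have l j : L j := xchoose (elimT card_gt0P (L_gt0 j)).
have R_ex j : exists c, c \in R j by apply/set0Pn.
pose c j := xchoose (R_ex j).
have cR j k : (c j \in R k) = (j == k).
  have [<- | neq_jk] := eqVneq j k; first exact: xchooseP.
  by apply: (disjointFr (R_disj j k neq_jk)); apply: xchooseP.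
have c_inj : injective c.
  by move=> j k eq_c; apply/eqP; rewrite -cR eq_c cR.
pose R_ k lt_k3 : gcomb L R := inr (c (@i k lt_k3)).
pose L_ k lt_k3 : gcomb L R := inl (Tagged L (l (@i k lt_k3))).
(* Together with [R_ 0], one vertex in each of three sets [R] gives the triangle; the leaves
   attached to the first two are the pendant vertices. *)
pose s := [:: R_ 1 isT; R_ 2 isT; L_ 0 isT; L_ 1 isT].
apply: (embeds_seq (x := R_ 0 isT) (s := s)).
  rewrite /= !inE /R_ /L_ !eqE /= !(inj_eq c_inj) //.
by move=> [|[|[|[|[|u]]]]] [|[|[|[|[|v]]]]] //=; rewrite ?andbF // => _;
   rewrite ?(inj_eq c_inj) ?cR.
Qed.

Lemma embeds_refl G : embeds G G.
Proof. by exists id; split=> // x y. Qed.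

Lemma calH_B11 K : calH_union K -> embeds B11 K.
Proof.
case=> -[|[|[|[|[|[|[|[|[|i]]]]]]]]] [] // _ /=; first exact: gcomb_B11.
1-5: by move/embeds_expansion/search_embeds; apply; vm_compute.
all: by move->; apply: (search_embeds (embeds_refl _)); vm_compute.
Qed.

(** * Classification of the graphs containing [B11] *)

Definition H2_pattern : nat * seq (nat * nat) :=
  (5, [:: (1, 2); (2, 3); (2, 4); (3, 4); (3, 5); (4, 6); (5, 6)]).
Definition H3_pattern : nat * seq (nat * nat) :=
  (5, [:: (1, 2); (1, 3); (2, 4); (3, 5); (6, 2); (6, 3); (6, 4); (6, 5)]).
Definition H4_pattern : nat * seq (nat * nat) :=
  (5, [:: (4, 5); (5, 6); (6, 4); (1, 4); (1, 6); (2, 4); (2, 5); (3, 5);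
          (3, 6)]).
Definition H5_pattern : nat * seq (nat * nat) :=
  (6, [:: (1, 3); (1, 5); (3, 4); (5, 6); (2, 4); (2, 6); (7, 3); (7, 4);
          (7, 5); (7, 6)]).
Definition H6_pattern : nat * seq (nat * nat) :=
  (6, [:: (1, 2); (1, 3); (1, 5); (3, 5); (3, 4); (2, 4); (2, 6); (4, 6);
          (5, 6); (5, 7); (6, 7)]).
Definition H7_pattern : nat * seq (nat * nat) := (7, H7_edges).
Definition H8_pattern : nat * seq (nat * nat) :=
  (8, H7_edges ++ [:: (9, 1); (9, 2); (9, 7); (9, 8)]).

(** The patterns above are convertible to the corresponding graphs, so a failed embedding test
    discharges the first premise directly. *)
Lemma avoids_cons G p F :
  ~ embeds (edge_list_graph p.1.+1 p.2) G -> avoids G F -> avoids G (p :: F).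
Proof. by move=> Gp G_F q; rewrite inE => /predU1P[-> | /G_F]. Qed.

Lemma B11_calH G : connected G -> avoids G K13_Z2 -> embeds B11 G ->
  exists K, calH_union K /\ isomorphic G K.
Proof.
move=> Gconn G0 G_B11.
have in_calH i : i <= 8 -> (exists K, calH i K /\ isomorphic G K) ->
    exists K, calH_union K /\ isomorphic G K.
  by move=> le_i8 [K [KH isoK]]; exists K; split=> //; exists i.
have [G_H8 | G_H8] := embedsP H8 G.
  apply: (in_calH 8) => //; exists H8; split=> //.
  by apply: (rigid_checkP Gconn G0 G_H8); vm_compute.
(* [H8] extends [H7] by one vertex, and [H7] extends [H6] by one, hence the descending order. *)
have [G_H7 | G_H7] := embedsP H7 G.
  apply: (in_calH 7) => //; exists H7; split=> //.
  apply: (rigid_checkP Gconn _ G_H7 (F := H8_pattern :: K13_Z2)).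
    exact: avoids_cons.
  by vm_compute.
have [G_H6 | G_H6] := embedsP H6 G.
  apply: (in_calH 6) => //; exists H6; split=> //.
  apply: (rigid_checkP Gconn _ G_H6 (F := H7_pattern :: K13_Z2)).
    exact: avoids_cons.
  by vm_compute.
have [G_H5 | G_H5] := embedsP H5 G.
  apply: (in_calH 5) => //.
  apply: (expansion_checkP Gconn _ G_H5 (F := H6_pattern :: K13_Z2)).
    exact: avoids_cons.
  by vm_compute.
have [G_H4 | G_H4] := embedsP H4 G.
  apply: (in_calH 4) => //.
  by apply: (expansion_checkP Gconn G0 G_H4); vm_compute.
have G_H56 : avoids G [:: H5_pattern, H6_pattern & K13_Z2].
  by do 2!apply: avoids_cons => //.
have [G_H3 | G_H3] := embedsP H3 G.
  apply: (in_calH 3) => //.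
  by apply: (expansion_checkP Gconn G_H56 G_H3); vm_compute.
have [G_H2 | G_H2] := embedsP H2 G.
  apply: (in_calH 2) => //.
  by apply: (expansion_checkP Gconn G_H56 G_H2); vm_compute.
(* A vertex whose only neighbour in a copy of [H1] is the third triangle vertex creates a net, so
   nets are treated before [H1]. *)
have [/embeds_copy[g g_copy] | G_net] := embedsP net G.
  by apply: (in_calH 0) => //; apply: net_comb g_copy.
(* [H1] is [B11] with another numbering, so it is searched for inside [B11] itself. *)
have G_H1 : embeds H1 G by apply: (search_embeds G_B11); vm_compute.
apply: (in_calH 1) => //.
apply: (expansion_checkP Gconn _ G_H1
  (F := [:: H2_pattern, H3_pattern, H4_pattern, (5, net_edges) & K13_Z2])).
  by do 4!apply: avoids_cons => //.
by vm_compute.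
Qed.

Theorem theorem1p1 (G : sgraph)
    (Gconn : connected G) (Gfree : free (pair_family K13 Z2) G) :
  ~ free (single B11) G <->
  exists K : sgraph, calH_union K /\ isomorphic G K.
Proof.
have G0 : avoids G K13_Z2.
  apply: avoids_cons => [G_K13 | ].
    by apply: (Gfree K13); [left | apply/has_inducedE].
  apply: avoids_cons => [G_Z2 | //].
  by apply: (Gfree Z2); [right | apply/has_inducedE].
split=> [not_free | [K [KH isoGK]] G_free].
  (* Decidability of embedding extracts a copy of [B11] from the negated freeness. *)
  apply: B11_calH => //; have [// | no_B11] := embedsP B11 G.
  by case: not_free => _ -> /has_inducedE.
case: (G_free B11 erefl); apply/has_inducedE.
apply: embeds_trans (calH_B11 KH) _.
exact/isomorphic_embeds/isomorphic_sym.
Qed.
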